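(* Let $G$ be a connected graph, let $\mathbb{K}$ be a field and $S=\mathbb{K}[x_i,y_i : i\in V(G)]$. Then $\operatorname{reg}(S/J_G^s)\geq 2s+\ell(G)-2$ for all $s\geq 1$, where $\ell(G)$ is the length of a longest induced path of $G$.
   Context: Graphs are finite and simple. For a graph $G$ with vertex set $V(G)=\{1,\dots,n\}$ and edge set $E(G)$, the binomial edge ideal is $J_G=(x_iy_j-x_jy_i : i<j,\ \{i,j\}\in E(G))\subset S=\mathbb{K}[x_1,\dots,x_n,y_1,\dots,y_n]$ (standard grading). An induced path is an induced subgraph that is a path; its length is its number of edges. $\operatorname{reg}$ denotes Castelnuovo–Mumford regularity over $S$.
   Formalization: The graph is assumed to have at least two vertices: for a single vertex J_G = 0, so reg(S/J_G^s) = 0 while 2s + ℓ(G) − 2 = 2s − 2 is positive for s ≥ 2, and the claim fails. *)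

(* Defs.v *)
From HB Require Import structures.
From mathcomp Require Import all_boot all_order all_algebra.
From mathcomp Require Import mpoly.

Set Implicit Arguments.
Unset Strict Implicit.
Unset Printing Implicit Defensive.

Import Order.TTheory GRing.Theory Num.Theory.
Local Open Scope ring_scope.

Definition simple_graph (n : nat) (e : rel 'I_n) : Prop :=
  ssrbool.symmetric e /\ irreflexive e.

Definition connected_graph (n : nat) (e : rel 'I_n) : Prop :=
  forall u v : 'I_n, connect e u v.

(* The k+1 listed vertices are distinct and induce the path with edges
   {p_a, p_(a+1)} in the graph e; the length of this path is k. *)
Definition induced_path (n : nat) (e : rel 'I_n) (k : nat)
    (p : k.+1.-tuple 'I_n) : bool :=
  uniq p && [forall a : 'I_k.+1, forall b : 'I_k.+1,
    e (tnth p a) (tnth p b) == ((a.+1 == b :> nat) || (b.+1 == a :> nat))].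

(* The bound k < n loses nothing: a path of length k has k + 1 vertices. *)
Definition longest_induced_path (n : nat) (e : rel 'I_n) : nat :=
  (\max_(k < n | [exists p : k.+1.-tuple 'I_n, induced_path e p]) k)%N.

Definition ideal_gen (N : nat) (K : fieldType) (A : {mpoly K[N]} -> Prop)
    (f : {mpoly K[N]}) : Prop :=
  exists cs : seq ({mpoly K[N]} * {mpoly K[N]}),
    (forall c, c \in cs -> A c.2) /\ f = \sum_(c <- cs) c.1 * c.2.

Definition ideal_pow (N : nat) (K : fieldType) (I : {mpoly K[N]} -> Prop)
    (s : nat) : {mpoly K[N]} -> Prop :=
  ideal_gen (fun f => exists g : 'I_s -> {mpoly K[N]},
    (forall k, I (g k)) /\ f = \prod_(k < s) g k).

(* S = K[x_1, ..., x_n, y_1, ..., y_n] *)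
Definition xvar (K : fieldType) (n : nat) (i : 'I_n) : {mpoly K[(n + n)%N]} :=
  'X_(lshift n i).
Definition yvar (K : fieldType) (n : nat) (i : 'I_n) : {mpoly K[(n + n)%N]} :=
  'X_(rshift n i).

Definition binomial_edge_ideal (K : fieldType) (n : nat) (e : rel 'I_n) :
    {mpoly K[(n + n)%N]} -> Prop :=
  ideal_gen (fun f => exists i j : 'I_n,
    [/\ (i < j)%N, e i j & f = xvar K i * yvar K j - xvar K j * yvar K i]).
Arguments binomial_edge_ideal K {n} e f : rename.

Definition homog_of_degree (N : nat) (K : fieldType) (z : int)
    (p : {mpoly K[N]}) : bool :=
  if z is Posz d then p \is d.-homog else p == 0.

(* An augmented sequence  ... -> F_2 -> F_1 -> F_0 -> S  of free modules
     F_i = S(- shift i 0) (+) ... (+) S(- shift i (rk i - 1)),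
   whose elements are column vectors; the basis element of index c of F_i has
   degree shift i c, diff i is the matrix of F_(i+1) -> F_i, and aug that of
   F_0 -> S. *)
Record free_sequence (N : nat) (K : fieldType) : Type := FreeSequence {
  rk : nat -> nat;
  shift : forall i : nat, 'I_(rk i) -> int;
  diff : forall i : nat, 'M[{mpoly K[N]}]_(rk i, rk i.+1);
  aug : 'rV[{mpoly K[N]}]_(rk 0)
}.
Arguments shift {N K} f i c.

(* F is a graded free resolution of the graded module S/I: the maps preserve
   degrees, and  ... -> F_1 -> F_0 -> S/I -> 0  is exact. *)
Definition graded_free_resolution (N : nat) (K : fieldType)
    (I : {mpoly K[N]} -> Prop) (F : free_sequence N K) : Prop :=
  [/\ (forall c, homog_of_degree (shift F 0 c) (aug F 0 c))
        /\ (forall i a b,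
              homog_of_degree (shift F i.+1 b - shift F i a) (diff F i a b)),
      forall f : {mpoly K[N]},
        exists u : 'cV[{mpoly K[N]}]_(rk F 0), I (f - (aug F *m u) 0 0),
      forall u : 'cV[{mpoly K[N]}]_(rk F 0),
        I ((aug F *m u) 0 0) <->
        exists w : 'cV[{mpoly K[N]}]_(rk F 1), u = diff F 0 *m w
    & forall (i : nat) (u : 'cV[{mpoly K[N]}]_(rk F i.+1)),
        diff F i *m u = 0 <->
        exists w : 'cV[{mpoly K[N]}]_(rk F i.+2), u = diff F i.+1 *m w].

(* F_(i+1) maps into m F_i, where m is the ideal generated by the variables,
   i.e. the set of polynomials whose constant coefficient is zero. *)
Definition minimal_resolution (N : nat) (K : fieldType)
    (F : free_sequence N K) : Prop :=
  forall i a b, (diff F i a b)@_0%MM = 0.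

(* r = reg(S/I) = max { j - i : S(-j) is a summand of F_i } for a minimal
   graded free resolution F of S/I. Such an F exists, is unique up to
   isomorphism and has finite length by Hilbert's syzygy theorem. *)
Definition is_regularity (N : nat) (K : fieldType) (I : {mpoly K[N]} -> Prop)
    (r : int) : Prop :=
  exists F : free_sequence N K,
    [/\ graded_free_resolution I F,
        minimal_resolution F,
        exists (i : nat) (c : 'I_(rk F i)), shift F i c - i%:Z = r
      & forall (i : nat) (c : 'I_(rk F i)), shift F i c - i%:Z <= r].

(* Main.v *)
From HB Require Import structures.
Require Import Defs.
From mathcomp Require Import all_boot all_order all_algebra.
From mathcomp Require Import mpoly.
From mathcomp Require Import zify ring.
From Stdlib Require Import ClassicalEpsilon.

Set Implicit Arguments.
Unset Strict Implicit.
Unset Printing Implicit Defensive.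

Import Order.TTheory GRing.Theory Num.Theory.
Local Open Scope ring_scope.

(* Let v_0, ..., v_k be an induced path with k = l(G), put
   f_a = x_a y_(a+1) - x_(a+1) y_a for a < k, and let I = J_G^s.  If
   reg(S/I) < 2s + k - 2, then every Koszul cycle of S/I in homological degree
   k and internal degree 2s + 2k - 2 is a boundary, because F_k has no generator
   in degrees >= 2s + 2k - 2.  The cycle
     f_0^(s-1) w_0 /\ ... /\ w_(k-1),
     w_a = x_a e_(y_(a+1)) - y_a e_(x_(a+1)),
   where w_a is sent to f_a by the Koszul differential, is not a boundary: set
   x_a = y_(a+1) = t_a for a < k and all the other variables to 0.  In
   K[t_0, ..., t_(k-1)] the cycle becomes a multiple of the top exterior form,
   with coefficient t_0^(2s-1) t_1 ... t_(k-1) up to sign, and J_G becomes the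
   ideal of the g_a = t_a^2 - t_(a-1) t_(a+1), where t_(-1) = t_k = 0.  This
   coefficient is not in the ideal (g_0^s, g_1, ..., g_(k-1)), which contains
   the image of I: the sum of the coefficients of the monomials
     t_0^(2s-1) t_1 ... t_(k-1) prod_a (t_a^2 / (t_(a-1) t_(a+1)))^(m_a),
   where m_a >= 0 and 0 < a < k - 1, vanishes on the ideal.
   The Koszul complex is taken on the linear coordinates x_i and
   y_(a+1) - x_a, so that all but k of them are sent to 0. *)

(** * Koszul complexes over a commutative ring: boundary, wedge, homotopy formula *)

Lemma big_antisym (V : zmodType) (N : nat) (F : 'I_N -> 'I_N -> V) :
    (forall i j, i != j -> F i j = - F j i) -> (forall i, F i i = 0) ->
  \sum_i \sum_j F i j = 0.
Proof.
move=> Fa F0.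
have -> : \sum_i \sum_j F i j =
    \sum_(i < N) \sum_(j < N) (if (i < j)%N then F i j else 0)
    + \sum_(i < N) \sum_(j < N) (if (j < i)%N then F i j else 0).
  rewrite -big_split; apply: eq_bigr => i _; rewrite -big_split.
  apply: eq_bigr => j _ /=; case: ltngtP => [_|_|/val_inj ->].
  - by rewrite addr0.
  - by rewrite add0r.
  - by rewrite F0 addr0.
rewrite [X in _ + X]exchange_big /= -big_split big1 // => i _.
rewrite -big_split big1 // => j _ /=; case: ifP => [lij|_]; last by rewrite addr0.
by rewrite (Fa i j) ?addNr //; apply/eqP => eij; rewrite eij ltnn in lij.
Qed.

Section Koszul.

Variables (A : comNzRingType) (N : nat).
Implicit Types (T : {set 'I_N}) (M : lmodType A) (theta : 'I_N -> A).

(** For i outside T, this is the sign in e_i /\ e_T = [ksign i T] e_(i |: T). *)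
Definition ksign (i : 'I_N) T : A := (-1) ^+ #|[set j in T | (j < i)%N]|.

Lemma ksignU i j T : j \notin T ->
  ksign i (j |: T) = (-1) ^+ (j < i)%N * ksign i T.
Proof.
move=> jT; rewrite /ksign -exprD; congr (_ ^+ _).
have -> : [set k in j |: T | (k < i)%N] =
  if (j < i)%N then j |: [set k in T | (k < i)%N] else [set k in T | (k < i)%N].
  apply/setP=> k; case: ifP => ji; rewrite !inE; case: eqP => //= ->.
    by rewrite ji.
  by rewrite ji andbF.
by case: ifP => // _; rewrite cardsU1 inE (negPf jT).
Qed.

Lemma ksignD1 i j T : j \in T ->
  ksign i T = (-1) ^+ (j < i)%N * ksign i (T :\ j).
Proof. by move=> jT; rewrite -{1}(setD1K jT) ksignU // setD11. Qed.

Lemma ksign_self i T : ksign i (T :\ i) = ksign i T.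
Proof.
rewrite /ksign; congr (_ ^+ _); apply: eq_card => k; rewrite !inE; case: eqP => //= ->.
by rewrite ltnn andbF.
Qed.

Lemma ksignK i T : ksign i T * ksign i T = 1.
Proof. by rewrite -expr2 sqrr_sign. Qed.

(* A function c on sets stands for the sum of the c(T) e_T, where e_T is the
   exterior product of the e_i, i in T, in increasing order. *)
Definition koszul_bdry M theta (c : {set 'I_N} -> M) T : M :=
  \sum_(i | i \notin T) (ksign i T * theta i) *: c (i |: T).

(** [q] is a map rather than a scalar: exactness will use division by X_k, which is not linear over
    the polynomial ring. *)
Definition koszul_wedge M (k : 'I_N) (q : M -> M) (c : {set 'I_N} -> M) T : M :=
  if k \in T then ksign k T *: q (c (T :\ k)) else 0.

(** The boundary evaluates [c] only at sets i |: T, so the value at [set0] may be changed freely. *)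
Lemma eq_koszul_bdry M theta (c c' : {set 'I_N} -> M) T :
  (forall U, U != set0 -> c U = c' U) ->
  koszul_bdry theta c T = koszul_bdry theta c' T.
Proof.
move=> cc'; apply: eq_bigr => i _; rewrite cc' //.
by apply/set0Pn; exists i; rewrite setU11.
Qed.

Lemma koszul_bdryD M theta (c c' : {set 'I_N} -> M) T :
  koszul_bdry theta (fun U => c U + c' U) T =
  koszul_bdry theta c T + koszul_bdry theta c' T.
Proof. by rewrite -big_split; apply: eq_bigr => i _; rewrite scalerDr. Qed.

Lemma koszul_bdryB M theta (c c' : {set 'I_N} -> M) T :
  koszul_bdry theta (fun U => c U - c' U) T =
  koszul_bdry theta c T - koszul_bdry theta c' T.
Proof. by rewrite -sumrB; apply: eq_bigr => i _; rewrite scalerBr. Qed.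

Lemma koszul_bdryK M theta (c : {set 'I_N} -> M) T :
  koszul_bdry theta (koszul_bdry theta c) T = 0.
Proof.
rewrite /koszul_bdry big_mkcond /=.
(* Extended by 0 to all pairs, the double sum is antisymmetric. *)
pose F i j := if [&& i \notin T, j \notin T & i != j] then
  (ksign i T * theta i * (ksign j (i |: T) * theta j)) *: c (j |: (i |: T)) else 0.
transitivity (\sum_i \sum_j F i j).
  apply: eq_bigr => i _; case: ifP => iT; last first.
    by rewrite big1 // => j _; rewrite /F iT.
  rewrite scaler_sumr big_mkcond /=; apply: eq_bigr => j _.
  rewrite /F iT !inE negb_or eq_sym andbC /=; case: ifP => //= _.
  by rewrite scalerA.
apply: big_antisym => [i j nij|i]; last by rewrite /F eqxx !andbF.
rewrite /F (eq_sym j i) nij !andbT andbC.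
case: ifP => [/andP[jT iT]|_]; last by rewrite oppr0.
rewrite setUCA -scaleNr; congr (_ *: _).
rewrite !ksignU //; case: ltngtP nij => [_|_|/val_inj ->]; rewrite ?eqxx //= => _; ring.
Qed.

(** The terms in which e_k is both inserted and removed give the right-hand side; the others vanish
    or cancel in pairs by opposite signs. For i = k no commutation is asked, so division by X_k
    qualifies. *)
Lemma koszul_homotopy M theta k (q : {additive M -> M}) (c : {set 'I_N} -> M) T :
    (forall i u, i != k -> q (theta i *: u) = theta i *: q u) ->
  koszul_bdry theta (koszul_wedge k q c) T + koszul_wedge k q (koszul_bdry theta c) T
  = if k \in T then q (theta k *: c T) else theta k *: q (c T).
Proof.
have qsgn U i u : q (ksign i U *: u) = ksign i U *: q u.
  by rewrite /ksign -signr_odd; case: odd; rewrite ?scale1r // expr1 !scaleN1r raddfN.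
move=> qth; rewrite {2}/koszul_wedge; case: ifP => kT; last first.
  rewrite addr0 /koszul_bdry (bigD1 k) ?kT //= big1 ?addr0.
    rewrite /koszul_wedge setU11 setU1K ?kT // scalerA -mulrA (mulrC (theta k)).
    rewrite mulrA; have := ksign_self k (k |: T); rewrite setU1K ?kT // => <-.
    by rewrite ksignK mul1r.
  move=> i /andP[iT nik]; rewrite /koszul_wedge !inE kT orbF eq_sym (negPf nik).
  by rewrite scaler0.
rewrite {2}/koszul_bdry (bigD1 k) ?setD11 //= raddfD /= scalerDr addrCA.
rewrite -scalerA qsgn scalerA ksign_self ksignK scale1r setD1K //.
rewrite raddf_sum scaler_sumr /= /koszul_bdry.
rewrite [X in _ + (X + _)](eq_bigl (fun i => (i \notin T :\ k) && (i != k))); last first.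
  by move=> i; rewrite !inE; case: eqP => [->|]; rewrite ?kT ?andbF ?andbT.
rewrite -big_split big1 ?addr0 // => i /andP[iTk nik] /=.
have iT : i \notin T by move: iTk; rewrite !inE nik.
rewrite /koszul_wedge !inE kT orbT -[(ksign i (T :\ k) * _) *: _]scalerA qsgn qth // !scalerA.
have -> : (i |: T) :\ k = i |: T :\ k.
  by apply/setP=> j; rewrite !inE; case: eqP => //= ->; rewrite eq_sym (negPf nik).
rewrite -scalerDl ksignU // (ksignD1 i kT).
set a := ksign k T; set b := ksign i _; set t := theta i.
suff -> : (-1) ^+ (k < i)%N * b * t * ((-1) ^+ (i < k)%N * a) + a * b * t = 0.
  by rewrite scale0r.
case: ltngtP nik => [_|_|/val_inj ->]; rewrite ?eqxx //= => _; ring.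
Qed.

(** Leibniz rule for x e_k: when [q] is a scalar, both cases of the homotopy formula agree. *)
Lemma koszul_bdry_wedge M theta k x (c : {set 'I_N} -> M) T :
  koszul_bdry theta (koszul_wedge k ( *:%R x) c) T =
  (theta k * x) *: c T - koszul_wedge k ( *:%R x) (koszul_bdry theta c) T.
Proof.
apply/eqP; rewrite -subr_eq opprK; apply/eqP.
rewrite (@koszul_homotopy M theta k ( *:%R x)) => [|i u _] /=.
  by rewrite !scalerA [x * _]mulrC if_same.
by rewrite !scalerA mulrC.
Qed.

End Koszul.

Lemma map_koszul_bdry (A B : comNzRingType) (f : {rmorphism A -> B}) N r
    (theta : 'I_N -> A) (c : {set 'I_N} -> 'cV[A]_r) T :
  map_mx f (koszul_bdry theta c T) =
  koszul_bdry (fun i => f (theta i)) (fun U => map_mx f (c U)) T.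
Proof.
rewrite raddf_sum; apply: eq_bigr => i _; apply/matrixP => a b.
by rewrite !mxE /= !rmorphM rmorph_sign.
Qed.

(** * Exactness of the Koszul complex of a polynomial ring *)

Section KoszulExact.

Variables (K : fieldType) (N : nat).
Local Notation S := {mpoly K[N]}.

(* (f - f|_{X_k = 0}) / X_k *)
Definition mdivX (k : 'I_N) (f : S) : S :=
  \sum_(m : 'X_{1..N < msize f}) f@_(m + U_(k)) *: 'X_[m].

Lemma mcoeff_mdivX k f m : (mdivX k f)@_m = f@_(m + U_(k)).
Proof.
have [lt_m|ge_m] := ltnP (mdeg m) (msize f).
  exact: (mcoeff_mpoly (fun m => f@_(m + U_(k)))).
rewrite [RHS]memN_msupp_eq0; last first.
  by apply: msize_mdeg_ge; rewrite mdegD (leq_trans ge_m) ?leq_addr.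
rewrite raddf_sum big1 // => i _ /=; rewrite mcoeffZ mcoeffX.
have /negPf -> : bmnm i != m; last by rewrite mulr0.
by apply: contraTneq (bmdeg i) => ->; rewrite -leqNgt.
Qed.

Lemma mdivX_is_additive k : additive (mdivX k).
Proof. by move=> f g; apply/mpolyP => m; rewrite !(mcoeffB, mcoeff_mdivX). Qed.

HB.instance Definition _ k := GRing.isAdditive.Build S S (mdivX k)
  (mdivX_is_additive k).

Lemma mcoeffXM i (f : S) m :
  ('X_i * f)@_m = if (0 < m i)%N then f@_(m - U_(i)) else 0.
Proof.
case: ifP => mi.
  have {1}<- : (m - U_(i) + U_(i))%MM = m.
    by apply: submK; apply/mnm_lepP => j; rewrite mnm1E; case: eqP => // <-.
  by rewrite mulrC addmC mcoeffMX.
rewrite memN_msupp_eq0 // mulrC (perm_mem (msuppMX _ _)); apply/mapP.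
by case=> u _ mu; rewrite mu mnmDE mnm1E eqxx in mi.
Qed.

Lemma mdivXM i k f : i != k -> mdivX k ('X_i * f) = 'X_i * mdivX k f.
Proof.
move=> nik; apply/mpolyP => m; rewrite mcoeff_mdivX !mcoeffXM mnmDE mnm1E.
rewrite eq_sym (negPf nik) addn0; case: ifP => // mi.
rewrite mcoeff_mdivX; congr (_@__); apply/mnmP => j.
rewrite !(mnmDE, mnmBE, mnm1E); by case: (i =P j) => [<-|_]; lia.
Qed.

Lemma mdivXK k f : mdivX k ('X_k * f) = f.
Proof.
apply/mpolyP => m; rewrite mcoeff_mdivX mcoeffXM mnmDE mnm1E eqxx addn1 /=.
by rewrite addmK.
Qed.

(** The remainder of the division is f with X_k set to 0. *)
Lemma mcoeff_sub_mdivX k f m :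
  (f - 'X_k * mdivX k f)@_m = if m k == 0%N then f@_m else 0.
Proof.
rewrite mcoeffB mcoeffXM lt0n; case: eqP => [_|/eqP mk]; first by rewrite subr0.
rewrite mcoeff_mdivX submK ?subrr //; apply/mnm_lepP => j; rewrite mnm1E.
by case: eqP => // <-; rewrite lt0n.
Qed.

(** Modulo boundaries, the variables are removed one at a time, both from the coefficients and from
    the sets T. What is left is a constant at [set0], which the second hypothesis rules out. *)
Lemma koszul_exactX r (c : {set 'I_N} -> 'cV[S]_r) :
    (forall T, koszul_bdry (fun i => 'X_i) c T = 0) ->
    (forall a, (c set0 a 0)@_0%MM = 0) ->
  exists y, forall T, c T = koszul_bdry (fun i => 'X_i) y T.
Proof.
move=> c_cyc c0.
suff [y [c' [ccy c'0]]] : exists y (c' : {set 'I_N} -> 'cV[S]_r),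
    (forall T, c T = koszul_bdry (fun i => 'X_i) y T + c' T) /\
    (forall T a (m : 'X_{1..N}), (c' T a 0)@_m != 0 ->
       (forall k, k \in enum 'I_N -> k \notin T /\ m k = 0%N) /\
       ((m == 0%MM) ==> (T != set0))).
  exists y => T; rewrite ccy [c' T](_ : _ = 0) ?addr0 //.
  apply/matrixP=> a b; rewrite ord1 mxE; apply/mpolyP => m; rewrite mcoeff0.
  apply/eqP; apply: contraT => /c'0[Tm].
  have [-> -> //] : m = 0%MM /\ T = set0; last by rewrite !eqxx.
  split; [apply/mnmP => k | apply/setP => k].
    by rewrite mnm0E; have [] := Tm k (mem_enum _ _).
  by have [/negPf -> _] := Tm k (mem_enum _ _); rewrite inE.
elim: (enum _) => [|k s [y [c' [ccy c'0]]]].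
  exists (fun=> 0), c; split=> [T|T a m cm].
    by rewrite /koszul_bdry big1 ?add0r // => i _; rewrite scaler0.
  split=> //; apply/implyP => /eqP m0; apply: contraNneq cm => ->.
  by rewrite m0 c0.
pose q := map_mx (mdivX k) : {additive 'cV[S]_r -> 'cV[S]_r}.
have c'_cyc T : koszul_bdry (fun i => 'X_i) c' T = 0.
  have := c_cyc T.
  rewrite (@eq_koszul_bdry _ _ _ _ c
    (fun U => koszul_bdry (fun i => 'X_i) y U + c' U)) //.
  by rewrite koszul_bdryD koszul_bdryK add0r.
(* By the homotopy formula, subtracting the boundary of this wedge kills [c'] on the sets containing
   [k] and sets X_k = 0 on the others. *)
exists (fun T => y T + koszul_wedge k q c' T).
exists (fun T : {set 'I_N} => if k \in T then 0 else c' T - 'X_k *: q (c' T)).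
split=> [T|T a m].
  rewrite koszul_bdryD ccy -addrA; congr (_ + _).
  have := @koszul_homotopy _ _ _ (fun i => 'X_i : S) k q c' T.
  rewrite {2}/koszul_wedge c'_cyc raddf0 scaler0 if_same addr0 => ->; last first.
    by move=> i u nik; apply/matrixP => a b; rewrite /q /= !mxE mdivXM.
  case: ifP => _; last by rewrite addrC subrK.
  by rewrite addr0; apply/matrixP => a b; rewrite /q /= !mxE mdivXK.
case: ifP => [_|kT]; first by rewrite mxE mcoeff0 eqxx.
rewrite /q /= !mxE mcoeff_sub_mdivX.
case: (m k =P 0%N) => [mk /c'0[Tm m0]|_]; last by rewrite eqxx.
by split=> // j; rewrite inE => /orP[/eqP ->|/Tm//]; rewrite kT.
Qed.

(** Applying [tau'] to all coefficients turns the coordinates tau X_i into the variables. *)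
Lemma koszul_exact (tau tau' : {rmorphism S -> S}) r
    (c : {set 'I_N} -> 'cV[S]_r) :
    cancel tau tau' -> cancel tau' tau -> (forall f, (tau' f)@_0%MM = f@_0%MM) ->
    (forall T, koszul_bdry (fun i => tau 'X_i) c T = 0) ->
    (forall a, (c set0 a 0)@_0%MM = 0) ->
  exists y, forall T, c T = koszul_bdry (fun i => tau 'X_i) y T.
Proof.
move=> tauK tauK' tau0 c_cyc c0.
have [|a|y cy] := @koszul_exactX r (fun T => map_mx tau' (c T)).
- move=> T; transitivity (map_mx tau' (koszul_bdry (fun i => tau 'X_i) c T)).
    by rewrite map_koszul_bdry; apply: eq_bigr => i _; rewrite tauK.
  by rewrite c_cyc raddf0.
- by rewrite mxE tau0.
exists (fun T => map_mx tau (y T)) => T.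
rewrite -(map_koszul_bdry tau (fun i => 'X_i)) -cy; apply/matrixP => a b.
by rewrite !mxE tauK'.
Qed.

End KoszulExact.

(** * Homogeneous parts of polynomials in integer degrees *)

Section HomogeneousPart.

Variables (K : fieldType) (N : nat).
Local Notation S := {mpoly K[N]}.
Implicit Types (z e : int) (f g : S).

Definition homog_part z f : S :=
  if z is Posz d then pihomog mdeg d f else 0.

Lemma homog_part_is_additive z : additive (homog_part z).
Proof. by case: z => d f g /=; rewrite ?raddfB ?subr0. Qed.

HB.instance Definition _ z := GRing.isAdditive.Build S S (homog_part z)
  (homog_part_is_additive z).

Lemma homog_partP z f : homog_of_degree z (homog_part z f).
Proof. by case: z => d //=; apply: pihomogP. Qed.

Lemma homog_part_id z f : homog_of_degree z f -> homog_part z f = f.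
Proof. by case: z => d /=; [apply: pihomog_dE | move/eqP]. Qed.

Lemma homog_partM e z g f : homog_of_degree e g ->
  homog_part z (g * f) = g * homog_part (z - e) f.
Proof.
case: e => [a ga|a /eqP ->]; last by rewrite !mul0r raddf0.
rewrite [f]mpolyE mulr_sumr !raddf_sum mulr_sumr; apply: eq_bigr => m _ /=.
rewrite -scalerAr; set c := f@_m.
have gm : g * 'X_[m] \is (a + mdeg m).-homog by apply: dhomogM; rewrite ?dhomogX.
case: z => d; last first.
  have [b ->] : exists b, Negz d - Posz a = Negz b by exists (d + a)%N; lia.
  by rewrite mulr0.
rewrite {1}/homog_part linearZ /=.
have [dam|ndam] := eqVneq d (a + mdeg m)%N.
  have -> : Posz d - Posz a = Posz (mdeg m) by lia.
  by rewrite dam pihomog_dE //= linearZ /= pihomogX eqxx scalerAr.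
rewrite (pihomog_ne0 _ gm) 1?eq_sym // scaler0.
case eb : (Posz d - Posz a) => [b|b] /=; last by rewrite mulr0.
rewrite linearZ /= pihomogX; case: eqP => [mb|_]; last by rewrite scaler0 mulr0.
have {}mb : mdeg m = b := mb.
by case/eqP: ndam; lia.
Qed.

Lemma homog_of_degree0 z : homog_of_degree z (0 : S).
Proof. by case: z => d /=; rewrite ?rpred0. Qed.

Lemma homog_of_degreeM z e f g :
  homog_of_degree z f -> homog_of_degree e g -> homog_of_degree (z + e) (f * g).
Proof.
move=> zf eg; have <- : homog_part (z + e) (f * g) = f * g.
  by rewrite (homog_partM _ _ zf) addrAC subrr add0r homog_part_id.
exact: homog_partP.
Qed.

Lemma homog_of_degree_coef0 z f : 0 < z -> homog_of_degree z f -> f@_0%MM = 0.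
Proof.
by case: z => // d d_gt0 /dhomog_nemf_coeff; apply; rewrite /= mdeg0; case: d d_gt0.
Qed.

Lemma ksign_homog (i : 'I_N) (T : {set 'I_N}) : homog_of_degree 0 (ksign S i T).
Proof.
rewrite /ksign -signr_odd; case: odd; rewrite /= ?expr1 ?rpredN; exact: dhomog1.
Qed.

End HomogeneousPart.

(** * Vanishing of Koszul homology of S/I, read off from a free resolution *)

Section KoszulResolution.

Variables (K : fieldType) (N : nat).
Local Notation S := {mpoly K[N]}.
Implicit Types T U : {set 'I_N}.

Lemma mulmx_koszul_bdry theta r r' (B : 'M[S]_(r', r)) (c : {set 'I_N} -> 'cV[S]_r) T :
  koszul_bdry theta (fun U => B *m c U) T = B *m koszul_bdry theta c T.
Proof. by rewrite mulmx_sumr; apply: eq_bigr => i _; rewrite -scalemxAr. Qed.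

Variables (tau tau' : {rmorphism S -> S}).
Hypotheses (tauK : cancel tau tau') (tauK' : cancel tau' tau).
Hypothesis tau0 : forall f, (tau' f)@_0%MM = f@_0%MM.
Hypothesis tau1 : forall i, tau 'X_i \is 1.-homog.
Local Notation theta := (fun i => tau 'X_i).

Variables (I : S -> Prop) (F : free_sequence N K).
Hypothesis F_res : graded_free_resolution I F.
Hypothesis I_max : forall f, I f -> f@_0%MM = 0.

Variables (l : nat) (j : int).
Hypothesis F_shift : forall c : 'I_(rk F l), shift F l c < j.

(* Staircase argument in the double complex (Koszul complex) (x) F: a class of
   internal degree j is pushed to F_l, where it lies in the maximal ideal. *)
Lemma koszul_staircase p i (z : {set 'I_N} -> 'cV[S]_(rk F i)) :
    (i + p)%N = l ->
    (forall T, #|T| != p -> z T = 0) ->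
    (forall T a, homog_of_degree (j - p%:Z - shift F i a) (z T a 0)) ->
    (forall T, exists w, koszul_bdry theta z T = diff F i *m w) ->
  exists y y', forall T, z T = koszul_bdry theta y T + diff F i *m y' T.
Proof.
case: F_res => [[_ diff_homog] _ _ diff_exact].
elim: p i z => [|p IHp] i z ipl zp z_homog z_bdry.
  (* Here i = l and [z] lives on [set0]; its entries have positive degree j - [shift F l a], hence
     no constant coefficient. *)
  have [|a|y zy] := @koszul_exact _ _ tau tau' _ z tauK tauK' tau0.
  - move=> T; rewrite (@eq_koszul_bdry _ _ _ _ _ (fun=> 0)).
      by rewrite /koszul_bdry big1 // => k _; rewrite scaler0.
    by move=> U U0; rewrite zp // cards_eq0.
  - apply: homog_of_degree_coef0 (z_homog set0 a); rewrite subr0 subr_gt0.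
    by move: a; rewrite (_ : i = l) // -ipl addn0.
  by exists y, (fun=> 0) => T; rewrite mulmx0 addr0.
have [w zw] := fin_all_exists z_bdry.
(* The lift [w] is arbitrary; keeping only its part of exterior degree p and internal degree j
   restores the induction hypotheses. *)
pose w' T : 'cV[S]_(rk F i.+1) := if #|T| == p then
  \col_b homog_part (j - p%:Z - shift F i.+1 b) (w T b 0) else 0.
have zw' T : koszul_bdry theta z T = diff F i *m w' T.
  rewrite /w'; case: ifP => Tp; last first.
    rewrite mulmx0 /koszul_bdry big1 // => k kT.
    by rewrite zp ?scaler0 // cardsU1 kT add1n eqSS Tp.
  apply/matrixP => a b; rewrite ord1 {b} mxE.
  have <- : homog_part (j - p%:Z - shift F i a) (koszul_bdry theta z T a 0) =
            koszul_bdry theta z T a 0.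
    rewrite /koszul_bdry summxE raddf_sum; apply: eq_bigr => k _.
    rewrite mxE /= homog_part_id //.
    have -> : j - p%:Z - shift F i a = (0 : int) + 1%:Z + (j - p.+1%:Z - shift F i a) by lia.
    apply: homog_of_degreeM; last exact: z_homog.
    by apply: homog_of_degreeM; [exact: ksign_homog | exact: tau1].
  rewrite zw mxE raddf_sum; apply: eq_bigr => b _ /=.
  rewrite (homog_partM _ _ (diff_homog i a b)) mxE; congr (_ * homog_part _ _).
  by ring.
have [|T /negPf nTp|T a|T|y1 [y1' wy]] := IHp i.+1 w'.
- by rewrite -ipl addnS.
- by rewrite /w' nTp.
- rewrite /w'; case: ifP => _; rewrite mxE; last exact: homog_of_degree0.
  exact: homog_partP.
(* [diff F i] maps the boundary of [w'] to the double boundary of [z], which is 0. *)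
- apply/diff_exact; rewrite -mulmx_koszul_bdry.
  transitivity (koszul_bdry theta (koszul_bdry theta z) T); last exact: koszul_bdryK.
  by apply: eq_bigr => k _; rewrite zw'.
(* The reset at [set0] does not affect boundaries, and makes [v] vanish there, because [z] lives on
   sets of size p + 1. *)
pose y2 T := if T == set0 then 0 else y1 T.
pose v T := z T - diff F i *m y2 T.
have [|a|y vy] := @koszul_exact _ _ tau tau' _ v tauK tauK' tau0.
- move=> T; rewrite koszul_bdryB zw'.
  rewrite (@eq_koszul_bdry _ _ _ _ _ (fun U => diff F i *m y1 U)).
    rewrite mulmx_koszul_bdry wy mulmxDr.
    have -> : diff F i *m (diff F i.+1 *m y1' T) = 0 by apply/diff_exact; exists (y1' T).
    by rewrite addr0 subrr.
  by move=> U /negPf U0; rewrite /y2 U0.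
- by rewrite /v /y2 eqxx mulmx0 subr0 zp ?cards0 // mxE mcoeff0.
by exists y, y2 => T; rewrite -vy subrK.
Qed.

(** As I lies in the maximal ideal, some entry of [aug F] has a nonzero constant coefficient; being
    homogeneous, it is a nonzero scalar and can be inverted. *)
Lemma aug_unit : exists u : 'cV[S]_(rk F 0), aug F *m u = 1%:M /\
  forall a, homog_of_degree (- shift F 0 a) (u a 0).
Proof.
case: F_res => [[aug_homog _] aug_surj _ _].
have [u /I_max] := aug_surj 1; rewrite mcoeffB mcoeff1 eqxx mxE raddf_sum mulr1n => /eqP.
rewrite subr_eq0 eq_sym => /eqP u1.
have [c augc] : exists c, (aug F 0 c)@_0%MM != 0.
  apply/existsP; apply: contraT; rewrite negb_exists => /forallP aug0.
  suff : (1 : K) = 0 by move/eqP; rewrite oner_eq0.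
  rewrite -u1 big1 // => c _ /=; rewrite (rmorphM (mcoeff 0%MM)) /=.
  by have := aug0 c; rewrite negbK => /eqP ->; rewrite mul0r.
have shc : shift F 0 c = 0 /\ aug F 0 c \is 0.-homog.
  have := aug_homog c; case: (shift F 0 c) => [[|d]|d] //=.
    move/dhomog_nemf_coeff => /(_ 0%MM); rewrite /= mdeg0 => /(_ isT) d0.
    by rewrite d0 eqxx in augc.
  by move/eqP => d0; rewrite d0 mcoeff0 eqxx in augc.
case: shc => shc /dhomog_nemf_coeff augc0.
have augcE : aug F 0 c = ((aug F 0 c)@_0%MM)%:MP.
  apply/mpolyP => m; rewrite mcoeffC; case: eqP => [->|/eqP m0]; rewrite ?mulr1 // mulr0.
  by apply: augc0; rewrite /= mdeg_eq0.
exists (((aug F 0 c)@_0%MM)^-1%:MP *: delta_mx c 0); split=> [|a].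
  rewrite -scalemxAr -colE; apply/matrixP => a b; rewrite !ord1 !mxE augcE.
  by rewrite mcoeffC eqxx mulr1 -mpolyCM mulVf.
rewrite !mxE; case: eqP => [->|_] /=; last by rewrite mulr0 homog_of_degree0.
by rewrite shc oppr0 mulr1 -[_%:MP]mulr1 mul_mpolyC; apply: dhomogZ; apply: dhomog1.
Qed.

(** This expresses that Tor_l(S/I, K) is 0 in degree j. The cycle is lifted to F_0 through
    [aug_unit], the staircase is run from i = 0 and p = l, and [aug F] brings the result back. *)
Lemma koszul_cycle_trivial (zeta : {set 'I_N} -> S^o) d :
    j = (l + d)%N ->
    (forall T, #|T| != l -> zeta T = 0) ->
    (forall T, (zeta T : S) \is d.-homog) ->
    (forall T, I (koszul_bdry theta zeta T)) ->
  exists y : {set 'I_N} -> S^o, forall T, I (zeta T - koszul_bdry theta y T).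
Proof.
move=> jld zeta_l zeta_d zetaI.
case: (F_res) => _ _ aug_exact _.
have [u [augu u_homog]] := aug_unit.
have aug_bdry (y : {set 'I_N} -> 'cV[S]_(rk F 0)) T :
    (aug F *m koszul_bdry theta y T) 0 0 =
    koszul_bdry theta (fun U => (aug F *m y U) 0 0 : S^o) T.
  rewrite -mulmx_koszul_bdry /koszul_bdry summxE; apply: eq_bigr => k _.
  by rewrite mxE.
have augz T : (aug F *m (zeta T *: u)) 0 0 = zeta T.
  by rewrite -scalemxAr augu !mxE mulr1.
have [||T a|T|y [y' zy]] := @koszul_staircase l 0 (fun T => zeta T *: u).
- by [].
- by move=> T /zeta_l ->; rewrite scale0r.
- rewrite mxE; have -> : j - l%:Z - shift F 0 a = d%:Z + - shift F 0 a by rewrite jld; lia.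
  by apply: homog_of_degreeM (u_homog a); apply: zeta_d.
- apply/aug_exact; rewrite aug_bdry.
  have -> : koszul_bdry theta (fun U => (aug F *m (zeta U *: u)) 0 0 : S^o) T =
      koszul_bdry theta zeta T.
    by apply: eq_bigr => k _; rewrite augz.
  exact: zetaI.
exists (fun T => (aug F *m y T) 0 0) => T.
have -> : zeta T = koszul_bdry theta (fun U => (aug F *m y U) 0 0 : S^o) T +
    (aug F *m (diff F 0 *m y' T)) 0 0.
  by rewrite -aug_bdry -[LHS]augz zy mulmxDr mxE.
by rewrite addrC addKr; apply/aug_exact; exists (y' T).
Qed.

End KoszulResolution.

(** * A linear functional on K[t_0, ..., t_(k-1)] that detects the cycle *)

Section SocleFunctional.

Variables (K : fieldType) (k s : nat).
Hypotheses (k_gt0 : (0 < k)%N) (s_gt0 : (0 < s)%N).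
Local Notation R := {mpoly K[k]}.
Implicit Types (b : 'X_{1..k}) (f g h : R).

Definition tvar (a : nat) : R := if insub a is Some i then 'X_i else 0.
Definition tvar_pred (a : nat) : R := if a is a'.+1 then tvar a' else 0.
(** Written as the image of x_a y_(a+1) - x_(a+1) y_a under x_a -> t_a, y_a -> t_(a-1); it equals
    g_a. *)
Definition path_quadric (a : nat) : R :=
  tvar a * tvar_pred a.+1 - tvar a.+1 * tvar_pred a.

(* The exponents of the monomials obtained from t_0^(2s-1) t_1 ... t_(k-1) by
   multiplying m(a) times by t_a^2 / (t_(a-1) t_(a+1)), 0 < a < k - 1. *)
Definition socle_orbit b : Prop := exists m : nat -> nat,
  [/\ m 0%N = 0%N, forall a, (k <= a.+1)%N -> m a = 0%N &
      forall i : 'I_k, (b i + m i.-1 + m i.+1 =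
        (if i == 0%N :> nat then (2 * s).-1 else 1) + 2 * m i)%N].

(** The degree bound only makes the sum finite: the moves preserve degree, so all orbit monomials
    have degree 2s + k - 2. *)
Definition socle_functional f : K :=
  \sum_(b : 'X_{1..k < 2 * s + k})
    if excluded_middle_informative (socle_orbit b) then f@_b else 0.

Lemma socle_functional_is_additive : additive socle_functional.
Proof.
move=> f g; rewrite -sumrB; apply: eq_bigr => b _.
by case: (excluded_middle_informative _) => o /=; rewrite ?mcoeffB ?subr0.
Qed.

HB.instance Definition _ := GRing.isAdditive.Build R K socle_functional
  socle_functional_is_additive.

Lemma socle_functionalZX c b : socle_functional (c *: 'X_[b]) =
  if (mdeg b < 2 * s + k)%N then
    if excluded_middle_informative (socle_orbit b) then c else 0
  else 0.
Proof.
rewrite /socle_functional; case: ifP => [lt_b|ge_b].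
  rewrite (bigD1 (BMultinom lt_b)) //= big1 ?addr0 => [|b' nb].
    by rewrite mcoeffZ mcoeffX eqxx mulr1.
  case: (excluded_middle_informative _) => //= o; rewrite mcoeffZ mcoeffX.
  have /negPf -> : b != bmnm b'; last by rewrite mulr0.
  by apply: contraNneq nb => bb; apply/eqP/val_inj.
rewrite big1 // => b' _; case: (excluded_middle_informative _) => //= o.
rewrite mcoeffZ mcoeffX; case: eqP => [bb|_]; last by rewrite mulr0.
by have := bmdeg b'; rewrite -bb ge_b.
Qed.

Lemma socle_functional_eq c b b' :
    mdeg b = mdeg b' -> (socle_orbit b <-> socle_orbit b') ->
  socle_functional (c *: 'X_[b]) = socle_functional (c *: 'X_[b']).
Proof.
move=> dd bb'; rewrite !socle_functionalZX dd; case: ifP => // _.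
by do 2!case: (excluded_middle_informative _) => ? /=; tauto.
Qed.

Lemma socle_functional_out c b :
  ~ socle_orbit b -> socle_functional (c *: 'X_[b]) = 0.
Proof.
by move=> nb; rewrite socle_functionalZX; case: ifP => // _;
  case: (excluded_middle_informative _).
Qed.

(** Passing from one monomial to the other changes m(i) by one, and i is interior, so the boundary
    conditions on m persist. *)
Lemma socle_orbit_move b (h i j : 'I_k) : h.+1 = i -> i.+1 = j ->
  socle_orbit (b + U_(i) + U_(i))%MM <-> socle_orbit (b + U_(h) + U_(j))%MM.
Proof.
move=> hi ij; have nbl (a : 'I_k) : (a.+1 == i :> nat) = (h == a :> nat) by lia.
have nbr (a : 'I_k) : (a.-1 == i :> nat) = (j == a :> nat) by lia.
split=> -[m [m0 mk mE]].
  (* The exponent at i is at least 2, whereas m(i) = 0 would bound it by 1. *)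
  have mi : (0 < m i)%N.
    have := mE i; rewrite !mnmDE !mnm1E eqxx; case: ifP; lia.
  pose m' a := if a == i :> nat then (m a).-1 else m a.
  have m'E a : (m' a + (a == i :> nat) = m a)%N.
    by rewrite /m'; case: eqP => [->|_]; lia.
  exists m'; split=> [|a ka|a].
  - by have := m'E 0%N; lia.
  - by have := m'E a; rewrite mk //; lia.
  have := mE a; rewrite !mnmDE !mnm1E -!val_eqE /= -!m'E nbl nbr (eq_sym (nat_of_ord i)).
  by lia.
pose m' a := if a == i :> nat then (m a).+1 else m a.
have m'E a : (m' a = m a + (a == i :> nat))%N.
  by rewrite /m'; case: eqP => _; lia.
exists m'; split=> [|a ka|a].
- by rewrite m'E m0 -hi.
- by rewrite m'E mk //; have := ltn_ord j; lia.
have := mE a; rewrite !mnmDE !mnm1E -!val_eqE /= !m'E nbl nbr (eq_sym (nat_of_ord i)).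
by lia.
Qed.

(** The largest ideal contained in the kernel of [socle_functional]. *)
Definition socle_ann g : Prop := forall h, socle_functional (h * g) = 0.

Lemma socle_ann0 : socle_ann 0.
Proof. by move=> h; rewrite mulr0 raddf0. Qed.

Lemma socle_annM f g : socle_ann g -> socle_ann (f * g).
Proof. by move=> g0 h; rewrite mulrA. Qed.

Lemma socle_annD f g : socle_ann f -> socle_ann g -> socle_ann (f + g).
Proof. by move=> f0 g0 h; rewrite mulrDr raddfD /= f0 g0 addr0. Qed.

Lemma socle_annX g : (forall c b, socle_functional (c *: 'X_[b] * g) = 0) ->
  socle_ann g.
Proof.
move=> g0 h; rewrite [h]mpolyE mulr_suml raddf_sum big1 //= => b _; exact: g0.
Qed.

Lemma tvarE (i : 'I_k) : tvar i = 'X_i.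
Proof. by rewrite /tvar; case: insubP => [j _ /val_inj ->|]; rewrite ?ltn_ord. Qed.

Lemma tvar_out a : (k <= a)%N -> tvar a = 0.
Proof. by move=> ka; rewrite /tvar insubF // ltnNge ka. Qed.

Lemma tvar_predE a : (0 < a)%N -> tvar_pred a = tvar a.-1.
Proof. by case: a. Qed.

(** For 0 < a < k - 1 the two monomials of g_a are exchanged by a move, so their values cancel. For
    a = k - 1 only t_a^2 is left, and it divides no orbit monomial because m(k-1) = 0. *)
Lemma path_quadric_ann a : (0 < a)%N -> socle_ann (path_quadric a).
Proof.
move=> a_gt0; have [ka|ak] := leqP k a.
  by move=> h; rewrite /path_quadric /= !tvar_out ?(leqW ka) // !mul0r subrr mulr0 raddf0.
pose i := Ordinal ak; have ti : tvar a = 'X_i by rewrite -(tvarE i).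
apply: socle_annX => c b; rewrite /path_quadric /= ti mulrBr raddfB /=.
rewrite -!scalerAl mulrA -!mpolyXD.
have [ka1|ak1] := leqP k a.+1.
  rewrite [tvar a.+1]tvar_out // mul0r mulr0 scaler0 raddf0 subr0.
  apply: socle_functional_out => -[m [m0 mk /(_ i)]].
  rewrite !mnmDE !mnm1E eqxx /= (mk a) // (gtn_eqF a_gt0); lia.
pose j := Ordinal ak1; have tj : tvar a.+1 = 'X_j by rewrite -(tvarE j).
have ah : (a.-1 < k)%N by rewrite (leq_ltn_trans (leq_pred a)).
pose h := Ordinal ah; have th : tvar_pred a = 'X_h.
  by rewrite -(tvarE h) tvar_predE.
rewrite tj th ['X_j * _]mulrC mulrA -!mpolyXD; apply/eqP; rewrite subr_eq0; apply/eqP.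
apply: socle_functional_eq; first by rewrite !mdegD !mdeg1.
by apply: socle_orbit_move => //=; rewrite prednK.
Qed.

(** Here g_0^s = t_0^(2s), while m(0) = 0 bounds the exponent of t_0 in the orbit by 2s - 1. *)
Lemma path_quadric0_ann : socle_ann (path_quadric 0 ^+ s).
Proof.
pose i := Ordinal k_gt0; apply: socle_annX => c b.
rewrite /path_quadric /= mulr0 subr0 -[0%N]/(val i) tvarE -expr2 -exprM.
rewrite -scalerAl mpolyXn -mpolyXD; apply: socle_functional_out => -[m [m0 _ /(_ i)]].
rewrite mnmDE mulmnE mnm1E eqxx /=; lia.
Qed.

(** This is the starting monomial of the orbit, with m = 0, factored the way the cycle will produce
    it. *)
Lemma socle_functional1 :
  socle_functional (tvar 0 ^+ (2 * s).-2 * \prod_(a < k) tvar a) = 1.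
Proof.
pose i := Ordinal k_gt0.
have -> : tvar 0 ^+ (2 * s).-2 * \prod_(a < k) tvar a =
    1 *: 'X_[U_(i) *+ (2 * s).-2 + \sum_(a < k) U_(a)].
  rewrite scale1r mpolyXD -mpolyXn -[0%N]/(val i) tvarE; congr (_ * _).
  by rewrite -mprodXE; apply: eq_bigr => a _; rewrite tvarE.
rewrite socle_functionalZX.
have -> : (mdeg (U_(i) *+ (2 * s).-2 + \sum_(a < k) U_(a)) < 2 * s + k)%N.
  rewrite mdegD mdegMn mdeg1 mdeg_sum (eq_bigr (fun=> 1%N)) => [|a _]; last exact: mdeg1.
  by rewrite sum_nat_const card_ord; lia.
case: (excluded_middle_informative _) => //= -[]; exists (fun=> 0%N); split=> // a.
rewrite mnmDE mulmnE mnm_sumE (bigD1 a) //= big1 => [|a' na]; last first.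
  by rewrite mnm1E (negPf na).
rewrite !mnm1E eqxx -val_eqE /= eq_sym; case: eqP => _ /=; lia.
Qed.

End SocleFunctional.

(** * Morphisms from polynomial rings; generated ideals and their powers *)

Lemma mpoly_rmorph_ext (K : fieldType) (N : nat) (A : comNzRingType)
    (f g : {rmorphism {mpoly K[N]} -> A}) :
  (forall c, f c%:MP = g c%:MP) -> (forall i, f 'X_i = g 'X_i) -> f =1 g.
Proof.
move=> fgC fgX u; rewrite [u]mpolyE !raddf_sum; apply: eq_bigr => m _ /=.
rewrite -mul_mpolyC !rmorphM /= fgC; congr (_ * _).
rewrite mpolyXE_id !rmorph_prod; apply: eq_bigr => i _.
by rewrite !rmorphXn /= fgX.
Qed.

Section IdealGen.

Variables (K : fieldType) (N : nat).
Local Notation S := {mpoly K[N]}.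
Implicit Types (A P : S -> Prop) (f g h : S).

Lemma ideal_gen_ind A P :
    P 0 -> (forall f g, P f -> P g -> P (f + g)) ->
    (forall h f, A f -> P (h * f)) ->
  forall f, ideal_gen A f -> P f.
Proof.
move=> P0 PD PA f [cs [csA ->]]; rewrite big_seq_cond.
by elim/big_ind: _ => // c /andP[/csA Ac _]; apply: PA.
Qed.

Lemma ideal_gen_mem A f : A f -> ideal_gen A f.
Proof.
move=> Af; exists [:: (1, f)]; split; last by rewrite big_seq1 mul1r.
by move=> c; rewrite inE => /eqP ->.
Qed.

Lemma ideal_gen0 A : ideal_gen A 0.
Proof. by exists [::]; split; rewrite ?big_nil. Qed.

Lemma ideal_genD A f g : ideal_gen A f -> ideal_gen A g -> ideal_gen A (f + g).
Proof.
move=> [cs [csA ->]] [ds [dsA ->]]; exists (cs ++ ds); rewrite big_cat; split=> //.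
by move=> c; rewrite mem_cat => /orP[/csA|/dsA].
Qed.

Lemma ideal_genM A h f : ideal_gen A f -> ideal_gen A (h * f).
Proof.
move=> [cs [csA ->]]; exists [seq (h * c.1, c.2) | c <- cs]; split.
  by move=> _ /mapP[c /csA Ac ->].
by rewrite big_map mulr_sumr; apply: eq_bigr => c _ /=; rewrite mulrA.
Qed.

Lemma ideal_genN A f : ideal_gen A f -> ideal_gen A (- f).
Proof. by rewrite -mulN1r; apply: ideal_genM. Qed.

Lemma ideal_pow_expM A s f g : (0 < s)%N ->
  ideal_gen A f -> ideal_gen A g -> ideal_pow (ideal_gen A) s (f ^+ s.-1 * g).
Proof.
case: s => // s _ fA gA; apply: ideal_gen_mem.
exists (fun i : 'I_s.+1 => if i == ord_max then g else f); split=> [i|].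
  by case: eqP.
rewrite big_ord_recr /= eqxx; congr (_ * _).
rewrite (eq_bigr (fun=> f)) ?prodr_const ?card_ord // => i _.
by rewrite -val_eqE /= ltn_eqF.
Qed.

End IdealGen.

(** * The Koszul cycle attached to an induced path *)

Section PathCycle.

Variables (K : fieldType) (n : nat) (e : rel 'I_n) (k : nat) (p : k.+1.-tuple 'I_n).
Variable s : nat.
Hypotheses (e_simple : simple_graph e) (p_induced : induced_path e p).
Hypotheses (k_gt0 : (0 < k)%N) (s_gt0 : (0 < s)%N).
Local Notation S := {mpoly K[n + n]}.
Local Notation R := {mpoly K[k]}.
Implicit Types T U : {set 'I_(n + n)}.

Let J := binomial_edge_ideal K e.
Let I := ideal_pow J s.

Definition path_vertex (a : nat) : 'I_n := nth (thead p) p a.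
Local Notation xi a := (lshift n (path_vertex a)).
Local Notation yi a := (rshift n (path_vertex a)).

Lemma index_path_vertex a : (a <= k)%N -> index (path_vertex a) p = a.
Proof.
by move=> ak; rewrite index_uniq ?size_tuple //; case/andP: p_induced.
Qed.

Lemma path_vertex_index v : (index v p <= k)%N -> path_vertex (index v p) = v.
Proof. by move=> vk; rewrite /path_vertex nth_index // -index_mem size_tuple. Qed.

Lemma path_edge a b : (a <= k)%N -> (b <= k)%N ->
  e (path_vertex a) (path_vertex b) = (a.+1 == b) || (b.+1 == a).
Proof.
rewrite -ltnS => ak; rewrite -ltnS => bk.
case/andP: p_induced => _ /forallP/(_ (Ordinal ak)).
by move/forallP/(_ (Ordinal bk))/eqP; rewrite !(tnth_nth (thead p)).
Qed.

Definition edge_binomial (a : nat) : S :=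
  'X_(xi a) * 'X_(yi a.+1) - 'X_(xi a.+1) * 'X_(yi a).

Lemma edge_binomialP a : (a < k)%N -> J (edge_binomial a).
Proof.
move=> ak; have eaa1 : e (path_vertex a) (path_vertex a.+1).
  by rewrite path_edge ?eqxx // ltnW.
have [lt|gt|eq] := ltngtP (path_vertex a) (path_vertex a.+1).
- by apply: ideal_gen_mem; exists (path_vertex a), (path_vertex a.+1).
- rewrite -[edge_binomial a]opprK; apply/ideal_genN/ideal_gen_mem.
  exists (path_vertex a.+1), (path_vertex a); split=> //; first by rewrite e_simple.1.
  by rewrite /edge_binomial opprB.
- by move: eaa1; rewrite (val_inj eq) e_simple.2.
Qed.

(* The new coordinates are X_i - path_shift i, which is y_(a+1) - x_a when i is
   the index of y_(a+1), 0 <= a < k, and X_i otherwise. *)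
Definition path_shift (i : 'I_(n + n)) : S :=
  if split i is inr v then
    let a := index v p in if (0 < a <= k)%N then 'X_(xi a.-1) else 0
  else 0.

Definition path_tau : S -> S := comp_mpoly [tuple 'X_i - path_shift i | i < n + n].
Definition path_tau' : S -> S := comp_mpoly [tuple 'X_i + path_shift i | i < n + n].
HB.instance Definition _ := GRing.RMorphism.on path_tau.
HB.instance Definition _ := GRing.RMorphism.on path_tau'.

Lemma path_tauX i : path_tau 'X_i = 'X_i - path_shift i.
Proof. by rewrite /path_tau comp_mpolyXU -tnth_nth tnth_mktuple. Qed.

Lemma path_tau'X i : path_tau' 'X_i = 'X_i + path_shift i.
Proof. by rewrite /path_tau' comp_mpolyXU -tnth_nth tnth_mktuple. Qed.

Lemma path_shift_x v : path_shift (lshift n v) = 0.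
Proof. by rewrite /path_shift (unsplitK (inl v)). Qed.

Lemma path_shift_y v : path_shift (rshift n v) =
  let a := index v p in if (0 < a <= k)%N then 'X_(xi a.-1) else 0.
Proof. by rewrite /path_shift (unsplitK (inr v)). Qed.

(** The shifts involve only x-variables, which both substitutions fix; hence adding and subtracting
    them are inverse to each other. *)
Lemma path_tau_shift i :
  path_tau (path_shift i) = path_shift i /\ path_tau' (path_shift i) = path_shift i.
Proof.
rewrite /path_shift; case: (split i) => [v|v /=]; first by rewrite !raddf0.
case: ifP => _; last by rewrite !raddf0.
by rewrite path_tauX path_tau'X path_shift_x subr0 addr0.
Qed.

Lemma path_tauK : cancel path_tau path_tau'.
Proof.
apply: (@mpoly_rmorph_ext _ _ _ (path_tau' \o path_tau) idfun) => [c|i] /=.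
  by rewrite /path_tau comp_mpolyC /path_tau' comp_mpolyC.
by rewrite path_tauX raddfB /= path_tau'X (path_tau_shift i).2 addrK.
Qed.

Lemma path_tauK' : cancel path_tau' path_tau.
Proof.
apply: (@mpoly_rmorph_ext _ _ _ (path_tau \o path_tau') idfun) => [c|i] /=.
  by rewrite /path_tau' comp_mpolyC /path_tau comp_mpolyC.
by rewrite path_tau'X raddfD /= path_tauX (path_tau_shift i).1 subrK.
Qed.

Lemma path_shift_homog i : path_shift i \is 1.-homog.
Proof.
rewrite /path_shift; case: (split i) => [v|v /=]; first exact: rpred0.
by case: ifP => _; rewrite ?rpred0 // dhomogX /= mdeg1.
Qed.

Lemma path_tau'0 f : (path_tau' f)@_0%MM = f@_0%MM.
Proof.
have -> : (path_tau' f)@_0%MM = (mcoeff 0%MM \o path_tau') f by [].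
apply: mpoly_rmorph_ext => [c|i] /=.
  by rewrite /path_tau' comp_mpolyC.
rewrite path_tau'X mcoeffD; suff -> : (path_shift i)@_0%MM = 0 by rewrite addr0.
by apply: (dhomog_nemf_coeff (path_shift_homog i)); rewrite /= mdeg0.
Qed.

Lemma path_tau1 i : path_tau 'X_i \is 1.-homog.
Proof. by rewrite path_tauX rpredB ?path_shift_homog // dhomogX /= mdeg1. Qed.

(** Off the path [index] returns k + 1, so both variables of such a vertex go to 0; so do x_k and
    y_0. *)
Definition path_phi : S -> R := comp_mpoly [tuple
  match split i with
  | inl v => tvar K k (index v p)
  | inr v => tvar_pred K k (index v p)
  end | i < n + n].
HB.instance Definition _ := GRing.RMorphism.on path_phi.

Lemma path_phi_x v : path_phi 'X_(lshift n v) = tvar K k (index v p).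
Proof.
by rewrite /path_phi comp_mpolyXU -tnth_nth tnth_mktuple (unsplitK (inl v)).
Qed.

Lemma path_phi_y v : path_phi 'X_(rshift n v) = tvar_pred K k (index v p).
Proof.
by rewrite /path_phi comp_mpolyXU -tnth_nth tnth_mktuple (unsplitK (inr v)).
Qed.

(** The positions of x_a, ..., x_(k-1). For a = 0 these are the k coordinates that survive
    [path_phi]. *)
Definition tail_set (a : nat) : {set 'I_(n + n)} :=
  [set xi (c : nat) | c : 'I_k & (a <= c)%N].

(** For a < k the coordinate y_(a+1) - x_a goes to t_a - t_a; the remaining ones are variables sent
    to 0. *)
Lemma path_phi_tau i : i \notin tail_set 0 -> path_phi (path_tau 'X_i) = 0.
Proof.
rewrite path_tauX raddfB /= -[i]splitK; case: (split i) => v /=.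
  rewrite path_shift_x raddf0 subr0 path_phi_x => vT; apply: tvar_out.
  rewrite leqNgt; apply: contra vT => vk; apply/imsetP.
  exists (Ordinal vk); rewrite ?inE //=.
  by rewrite path_vertex_index // ltnW.
move=> _; rewrite path_shift_y path_phi_y /=; case: ifP => [/andP[v0 vk]|].
  rewrite path_phi_x index_path_vertex ?(leq_trans (leq_pred _)) //.
  by rewrite tvar_predE // subrr.
rewrite raddf0 subr0; case: (index v p) => //= a /negbT; rewrite -ltnNge => ka.
exact: tvar_out.
Qed.

Lemma path_phi_binomial a : (a < k)%N -> path_phi (edge_binomial a) = path_quadric K k a.
Proof.
move=> ak; rewrite /edge_binomial raddfB /= !rmorphM /= !path_phi_x !path_phi_y.
by rewrite !index_path_vertex // ltnW.
Qed.

(** The ideal (g_0) + [socle_ann], which contains every g_a and therefore the image of J_G. *)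
Definition quadric_span (u : R) : Prop :=
  exists c v, socle_ann s v /\ u = c * path_quadric K k 0 + v.

Lemma quadric_spanD u v : quadric_span u -> quadric_span v -> quadric_span (u + v).
Proof.
move=> [c [f [fa ->]]] [d [g [ga ->]]]; exists (c + d), (f + g).
by split; [apply: socle_annD | rewrite mulrDl addrACA].
Qed.

Lemma quadric_spanM h u : quadric_span u -> quadric_span (h * u).
Proof.
move=> [c [f [fa ->]]]; exists (h * c), (h * f).
by split; [apply: socle_annM | rewrite mulrDr mulrA].
Qed.

Lemma quadric_span0 : quadric_span 0.
Proof. by exists 0, 0; rewrite mul0r add0r; split=> //; exact: socle_ann0. Qed.

Lemma quadric_span_quadric a : quadric_span (path_quadric K k a).
Proof.
case: (posnP a) => [->|a_gt0].
  by exists 1, 0; rewrite mul1r addr0; split=> //; exact: socle_ann0.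
by exists 0, (path_quadric K k a); rewrite mul0r add0r; split=> //; apply: path_quadric_ann.
Qed.

Lemma path_phi_edge_ideal f : J f -> quadric_span (path_phi f).
Proof.
move: f; apply: ideal_gen_ind => [|f g|h f [i [j [_ eij ->]]]].
- by rewrite raddf0; apply: quadric_span0.
- by rewrite raddfD; apply: quadric_spanD.
rewrite rmorphM; apply: quadric_spanM.
rewrite raddfB /= !rmorphM /= !path_phi_x !path_phi_y.
have [ik|ik] := ltnP k (index i p).
  have -> : tvar_pred K k (index i p) = 0.
    by rewrite tvar_predE ?tvar_out //; lia.
  by rewrite tvar_out ?(ltnW ik) // mul0r mulr0 subrr; apply: quadric_span0.
have [jk|jk] := ltnP k (index j p).
  have -> : tvar_pred K k (index j p) = 0.
    by rewrite tvar_predE ?tvar_out //; lia.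
  rewrite [tvar _ _ (index j p)]tvar_out ?(ltnW jk) // mul0r mulr0 subrr.
  exact: quadric_span0.
(* Both ends lie on the path, which is induced, so they are consecutive and the generator maps to
   some g_a up to sign. *)
have := path_edge ik jk; rewrite !path_vertex_index // eij.
case/esym/orP => /eqP <-; first exact: quadric_span_quadric.
rewrite -[_ - _]opprK opprB -mulN1r; apply: quadric_spanM; exact: quadric_span_quadric.
Qed.

(** In the expanded product, every term other than the multiple of g_0^m has a factor in the ideal
    [socle_ann]. *)
Lemma quadric_span_prod m (u : 'I_m -> R) : (forall i, quadric_span (u i)) ->
  exists c v, socle_ann s v /\ \prod_(i < m) u i = c * path_quadric K k 0 ^+ m + v.
Proof.
elim: m u => [|m IHm] u uJ.
  by exists 1, 0; rewrite big_ord0 expr0 mulr1 addr0; split=> //; exact: socle_ann0.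
have [c [v [va Ev]]] := IHm (fun i => u (lift ord0 i)) (fun i => uJ _).
have [d [w [wa Ew]]] := uJ ord0.
exists (d * c), (d * path_quadric K k 0 * v + \prod_(i < m) u (lift ord0 i) * w).
split; first by apply: socle_annD; apply: socle_annM.
by rewrite big_ord_recl Ew Ev exprS; ring.
Qed.

Lemma path_phi_ideal_pow f : I f -> socle_ann s (path_phi f).
Proof.
move: f; apply: ideal_gen_ind => [|f g|h f [g [gJ ->]]].
- by rewrite raddf0; exact: socle_ann0.
- by rewrite raddfD; apply: socle_annD.
rewrite rmorphM; apply: socle_annM; rewrite rmorph_prod.
have [|c [v [va ->]]] := @quadric_span_prod s (fun i => path_phi (g i)).
  by move=> i; apply: path_phi_edge_ideal.
by apply: socle_annD => //; apply: socle_annM; apply: path_quadric0_ann.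
Qed.

Lemma ideal_pow_max f : I f -> f@_0%MM = 0.
Proof.
move: f; apply: ideal_gen_ind => [|f g f0 g0|h f [g [gJ ->]]].
- exact: mcoeff0.
- by rewrite mcoeffD f0 g0 addr0.
case: s s_gt0 g gJ => // m _ g gJ; rewrite big_ord_recl !rmorphM /=.
suff -> : (g ord0)@_0%MM = 0 by rewrite mul0r mulr0.
move: (g ord0) (gJ ord0); apply: ideal_gen_ind => [|f1 f2 f0 g0|h' f1 [i [j [_ _ ->]]]].
- exact: mcoeff0.
- by rewrite mcoeffD f0 g0 addr0.
by rewrite rmorphM raddfB /= !rmorphM /= !mcoeffX !mnm1_eq0 !mul0r subrr mulr0.
Qed.

(* y_(a+1) = (y_(a+1) - x_a) + x_a, so in the new coordinates e_(y_(a+1)) is the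
   sum of two basis vectors. *)
Definition edge_wedge (a : nat) (c : {set 'I_(n + n)} -> S^o) T : S^o :=
  koszul_wedge (yi a.+1) ( *:%R ('X_(xi a) : S)) c T
  + koszul_wedge (xi a) ( *:%R ('X_(xi a) : S)) c T
  - koszul_wedge (xi a.+1) ( *:%R ('X_(yi a) : S)) c T.

Local Notation theta := (fun i => path_tau 'X_i).

(** Leibniz rule for w_a, whose boundary is (y_(a+1) - x_a) x_a + x_a x_a - x_(a+1) y_a = f_a. *)
Lemma koszul_bdry_edge_wedge a c T : (a < k)%N ->
  koszul_bdry theta (edge_wedge a c) T =
  edge_binomial a * c T - edge_wedge a (koszul_bdry theta c) T.
Proof.
move=> ak; rewrite /edge_wedge.
rewrite koszul_bdryB koszul_bdryD !koszul_bdry_wedge !path_tauX !path_shift_x path_shift_y.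
rewrite index_path_vertex //= ak !subr0 /edge_binomial.
have ringE (x y z w d u v t : S) : (y - x) * x * d - u + (x * x * d - v) - (z * w * d - t)
  = (x * y - z * w) * d - (u + v - t) by ring.
exact: ringE.
Qed.

Fixpoint path_cycle (l : seq nat) : {set 'I_(n + n)} -> S^o :=
  if l is a :: l' then edge_wedge a (path_cycle l')
  else fun T => if T == set0 then edge_binomial 0 ^+ s.-1 else 0.

Lemma path_cycle_size l T : #|T| != size l -> path_cycle l T = 0.
Proof.
elim: l T => [|a l IHl] T /=; first by rewrite cards_eq0 => /negPf ->.
move=> Tl; have wedge0 i x : koszul_wedge i ( *:%R x) (path_cycle l) T = 0.
  rewrite /koszul_wedge; case: ifP => // iT; rewrite IHl ?scaler0 //.
  by move: Tl; rewrite (cardsD1 i) iT.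
by rewrite /edge_wedge !wedge0 subr0 addr0.
Qed.

Lemma edge_binomial_homog a : edge_binomial a \is 2.-homog.
Proof.
have X2 i j : ('X_i * 'X_j : S) \is 2.-homog.
  by apply: (@dhomogM _ _ _ 1 _ 1); rewrite dhomogX /= mdeg1.
exact: rpredB.
Qed.

Lemma path_cycle_homog l T :
  (path_cycle l T : S) \is (2 * s.-1 + size l).-homog.
Proof.
elim: l T => [|a l IHl] T /=.
  by rewrite addn0; case: ifP => _; rewrite ?rpred0 // dhomogMn // edge_binomial_homog.
have wedge_homog i j : (koszul_wedge i ( *:%R 'X_j) (path_cycle l) T : S)
    \is (2 * s.-1 + (size l).+1).-homog.
  rewrite /koszul_wedge; case: ifP => // _; last exact: rpred0.
  rewrite -[X in X.-homog]add0n; apply: dhomogM; first exact: (@ksign_homog K).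
  by rewrite addnS -add1n; apply: dhomogM (IHl _); rewrite dhomogX /= mdeg1.
by rewrite /edge_wedge rpredB ?rpredD.
Qed.

(** The factor f_0^(s-1) is kept so that each f_a produced by the boundary completes it to an
    element of J_G^s. *)
Lemma path_cycle_dvd l T : exists f, path_cycle l T = f * edge_binomial 0 ^+ s.-1.
Proof.
elim: l T => [|a l IHl] T /=.
  by case: ifP => _; [exists 1; rewrite mul1r | exists 0; rewrite mul0r].
have wedge_dvd i x : exists f,
    koszul_wedge i ( *:%R x) (path_cycle l) T = f * edge_binomial 0 ^+ s.-1.
  rewrite /koszul_wedge; case: ifP => // _; last by exists 0; rewrite mul0r.
  have [f ->] := IHl (T :\ i); exists (ksign _ i T * (x * f)).
  by rewrite -!mulrA.
have [f Ef] := wedge_dvd (yi a.+1) 'X_(xi a).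
have [g Eg] := wedge_dvd (xi a) 'X_(xi a).
have [h Eh] := wedge_dvd (xi a.+1) 'X_(yi a).
by exists (f + g - h); rewrite /edge_wedge Ef Eg Eh mulrBl mulrDl.
Qed.

Lemma path_cycle_bdry l T : all (ltn^~ k) l -> I (koszul_bdry theta (path_cycle l) T).
Proof.
elim: l T => [|a l IHl] T /=.
  move=> _; rewrite (@eq_koszul_bdry _ _ _ _ _ (fun=> 0)).
    rewrite /koszul_bdry big1 => [|i _]; [exact: ideal_gen0 | exact: scaler0].
  by move=> U /negPf ->.
case/andP=> ak lk; rewrite koszul_bdry_edge_wedge //.
apply: ideal_genD; last apply: ideal_genN.
  have [f ->] := path_cycle_dvd l T; rewrite mulrCA; apply: ideal_genM.
  by rewrite mulrC; apply: ideal_pow_expM => //; apply: edge_binomialP.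
have wedgeI i x : I (koszul_wedge i ( *:%R x) (koszul_bdry theta (path_cycle l)) T).
  rewrite /koszul_wedge; case: ifP => _; last exact: ideal_gen0.
  by do 2!apply: ideal_genM; apply: IHl.
by apply: ideal_genD; [apply: ideal_genD | apply: ideal_genN]; apply: wedgeI.
Qed.

Lemma tail_set_out a : (a <= k)%N -> xi a \notin tail_set a.+1.
Proof.
move=> ak; apply/imsetP => -[c]; rewrite inE => ac /lshift_inj cE.
have := index_path_vertex ak; rewrite cE index_path_vertex ?(ltnW (ltn_ord c)) // => ca.
by rewrite ca ltnn in ac.
Qed.

Lemma tail_setE a : (a < k)%N -> tail_set a = xi a |: tail_set a.+1.
Proof.
move=> ak; apply/setP => i; rewrite !inE; apply/imsetP/orP => [[c]|].
  rewrite inE leq_eqVlt => /orP[/eqP <- ->|ac ->]; first by left.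
  by right; apply/imsetP; exists c; rewrite ?inE.
case=> [/eqP ->|/imsetP[c]]; first by exists (Ordinal ak); rewrite ?inE /=.
by rewrite inE => ac ->; exists c; rewrite // inE ltnW.
Qed.

(** On sets inside [tail_set 0] the y-part of w_a is invisible, and its x_(a+1)-part either lies
    outside (a + 1 = k) or repeats a factor already present. Only t_a e_(x_a) remains, so a single
    exterior monomial survives. *)
Lemma path_phi_cycle m a : (a + m = k)%N -> exists b : nat, forall T,
    T \subset tail_set 0 ->
  path_phi (path_cycle (iota a m) T) = if T == tail_set a then (-1) ^+ b *
    (path_quadric K k 0 ^+ s.-1 * \prod_(c < k | (a <= c)%N) tvar K k c) else 0.
Proof.
elim: m a => [|m IHm] a amk.
  have -> : tail_set a = set0.
    apply/setP => i; rewrite inE; apply/imsetP => -[c]; rewrite inE.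
    by have := ltn_ord c; lia.
  exists 0%N => T _ /=; case: ifP => _; last by rewrite raddf0.
  rewrite rmorphXn /= path_phi_binomial // expr0 mul1r big_pred0 ?mulr1 // => c.
  by apply/negbTE; rewrite -ltnNge; have := ltn_ord c; lia.
have ak : (a < k)%N by lia.
have [|b IHb] := IHm a.+1; first lia.
(* Vertex numbers need not increase along the path; the first summand counts the transpositions that
   put e_(x_a) in its place. *)
exists (#|[set j in tail_set a | (j < xi a)%N]| + b)%N => T TT0 /=.
have wedge_phi i x : path_phi (koszul_wedge i ( *:%R x) (path_cycle (iota a.+1 m)) T) =
    if (i \in T) && (T :\ i == tail_set a.+1) then
      path_phi (ksign S i T) * (path_phi x * ((-1) ^+ b *
        (path_quadric K k 0 ^+ s.-1 * \prod_(c < k | (a < c)%N) tvar K k c)))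
    else 0.
  rewrite /koszul_wedge; case: ifP => iT /=; last by rewrite raddf0.
  rewrite !rmorphM /= IHb; first by case: ifP; rewrite ?mulr0.
  by apply: subset_trans TT0; apply: subD1set.
rewrite /edge_wedge raddfB raddfD /= !wedge_phi.
have -> : (yi a.+1 \in T) = false.
  apply/negP => /(subsetP TT0)/imsetP[c _ /eqP].
  by rewrite eq_rlshift.
have -> : (xi a.+1 \in T) && (T :\ xi a.+1 == tail_set a.+1) = false.
  apply/negP => /andP[/(subsetP TT0)/imsetP[c _ /lshift_inj cE]] /eqP TE.
  have ac : a.+1 = c.
    by have := index_path_vertex ak; rewrite cE index_path_vertex ?(ltnW (ltn_ord c)).
  have : xi a.+1 \in T :\ xi a.+1.
    by rewrite TE; apply/imsetP; exists c; rewrite ?inE -ac.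
  by rewrite !inE eqxx.
rewrite /= add0r subr0.
have -> : (xi a \in T) && (T :\ xi a == tail_set a.+1) = (T == tail_set a).
  apply/andP/eqP => [[aT /eqP TE]|->].
    by rewrite tail_setE // -TE setD1K.
  by rewrite tail_setE // setU11 setU1K ?tail_set_out // ltnW.
case: eqP => // ->; rewrite path_phi_x index_path_vertex ?(ltnW ak) //.
rewrite /ksign rmorphXn rmorphN1 exprD [in RHS](bigD1 (Ordinal ak)) //=.
rewrite [X in _ = _ * (_ * (_ * X))](eq_bigl (fun c : 'I_k => (a < c)%N)); first by ring.
by move=> c; rewrite ltn_neqAle -val_eqE /= eq_sym andbC.
Qed.

(** At [tail_set 0] the boundary involves only coordinates outside this set, all killed by
    [path_phi]; the functional then takes the value 1 or -1 on the cycle. *)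
Lemma path_cycle_nontrivial (y : {set 'I_(n + n)} -> S^o) :
  ~ I (path_cycle (iota 0 k) (tail_set 0) - koszul_bdry theta y (tail_set 0)).
Proof.
move=> /path_phi_ideal_pow /(_ 1); rewrite mul1r raddfB /=.
have -> : path_phi (koszul_bdry theta y (tail_set 0)) = 0.
  rewrite raddf_sum big1 // => i iT /=.
  by rewrite !rmorphM /= path_phi_tau // mulr0 mul0r.
have [b ->] // := path_phi_cycle (add0n k); rewrite eqxx subr0.
have -> : path_quadric K k 0 ^+ s.-1 = tvar K k 0 ^+ (2 * s).-2.
  by rewrite /path_quadric /= mulr0 subr0 -expr2 -exprM; congr (_ ^+ _); lia.
rewrite -signr_odd; have := socle_functional1 K k_gt0 s_gt0.
case: odd => f1; rewrite ?mul1r ?mulN1r ?raddfN /= f1 => /eqP;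
  by rewrite ?oppr_eq0 oner_eq0.
Qed.

Lemma regularity_induced_path r : is_regularity I r -> (2 * s + k)%N%:Z - 2 <= r.
Proof.
case=> F [F_res _ _ F_shift]; rewrite leNgt; apply/negP => r_lt.
(* The bound is homological degree k plus coefficient degree 2(s - 1) + k of the cycle. *)
have Fk c : shift F k c < (k + (2 * s.-1 + k))%N.
  by have := F_shift k c; lia.
have [//|T|T|T|y Iy] := koszul_cycle_trivial path_tauK path_tauK' path_tau'0
  path_tau1 F_res ideal_pow_max Fk (zeta := path_cycle (iota 0 k)) (d := (2 * s.-1 + k)%N).
- by move=> Tk; apply: path_cycle_size; rewrite size_iota.
- by have := path_cycle_homog (iota 0 k) T; rewrite size_iota.
- by apply: path_cycle_bdry; apply/allP => a; rewrite mem_iota.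
exact: path_cycle_nontrivial (Iy _).
Qed.

End PathCycle.

(** * Existence of a longest induced path of positive length, and the conclusion *)

Lemma induced_path1 n (e : rel 'I_n) u v : simple_graph e -> e u v ->
  induced_path e [tuple u; v].
Proof.
move=> [e_sym e_irr] euv; apply/andP; split.
  by rewrite /= inE andbT; apply: contraTneq euv => ->; rewrite e_irr.
apply/forallP => a; apply/forallP => b; rewrite !(tnth_nth u).
by case: a => [[|[|]]] //= ?; case: b => [[|[|]]] //= ?; rewrite ?e_irr ?euv // e_sym euv.
Qed.

(** A walk between two distinct vertices starts with an edge, which is an induced path of length 1;
    hence the maximum runs over a nonempty family and is positive. *)
Lemma longest_induced_path_attained n (e : rel 'I_n) :
    (1 < n)%N -> simple_graph e -> connected_graph e ->
  (0 < longest_induced_path e)%N /\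
  exists p : (longest_induced_path e).+1.-tuple 'I_n, induced_path e p.
Proof.
move=> n_gt1 e_simple e_conn.
have [u [v euv]] : exists u v, e u v.
  have /connectP[[|v q] /= pq lq] := e_conn (Ordinal (ltnW n_gt1)) (Ordinal n_gt1).
    by [].
  by exists (Ordinal (ltnW n_gt1)), v; case/andP: pq.
have P1 : [exists p : 2.-tuple 'I_n, induced_path e p].
  by apply/existsP; exists [tuple u; v]; apply: induced_path1.
pose k1 := Ordinal n_gt1.
split; first exact: (@leq_bigmax_cond _ _ (fun k : 'I_n => k : nat) k1).
have [|k /existsP Pk mk] := @eq_bigmax_cond _
  [pred k : 'I_n | [exists p : k.+1.-tuple 'I_n, induced_path e p]]
  (fun k : 'I_n => k : nat).
  by apply/card_gt0P; exists k1.
by rewrite /longest_induced_path mk.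
Qed.

Theorem corollary3p4 (K : fieldType) (n : nat) (e : rel 'I_n)
    (n_gt1 : (1 < n)%N)
    (e_simple : simple_graph e) (e_conn : connected_graph e)
    (s : nat) (s_gt0 : (0 < s)%N)
    (r : int)
    (reg_r : is_regularity (ideal_pow (binomial_edge_ideal K e) s) r) :
  (2 * s + longest_induced_path e)%N%:Z - 2 <= r.
Proof.
have [l_gt0 [p p_ind]] := longest_induced_path_attained n_gt1 e_simple e_conn.
exact: (regularity_induced_path e_simple p_ind l_gt0 s_gt0 reg_r).
Qed.
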